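(* Let $d\geq 1$ and $n\geq 1$ be integers and let $\varphi$ be a form of degree $d$ over the rational function field $\mathbb{Q}(t_1,\dots,t_n)$ of dimension greater than $d^{n+2}$. Then $\varphi$ is isotropic over the field $\mathbb{Q}_p(t_1,\dots,t_n)$ for all but finitely many primes $p$.
   Context: A form of degree $d$ and dimension $m$ over a field $F$ is a homogeneous polynomial of degree $d$ in $m$ variables with coefficients in $F$. It is isotropic over a field extension $L$ of $F$ if it has a nontrivial zero in $L^m$. $\mathbb{Q}_p$ denotes the field of $p$-adic numbers. *)

(* Defs.v *)
From HB Require Import structures.
From mathcomp Require Import all_boot all_algebra fraction generic_quotient.
From mathcomp Require Import boolp.
From mathcomp Require Import mpoly.

Set Implicit Arguments.
Unset Strict Implicit.
Unset Printing Implicit Defensive.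

Import GRing.Theory.
Local Open Scope ring_scope.

(* Z_p is the inverse limit of the rings Z/p^k: an element is the sequence of
   its residues, the residue mod p^k being the representative in [0, p^k).
   The equation below already forces x k < p ^ k. *)
Definition coherent (p : nat) (x : nat -> nat) : Prop :=
  forall k, (x k.+1 %% p ^ k = x k)%N.

Record padic_int (p : nat) (pr : prime p) := PadicInt {
  padic_res :> nat -> nat;
  padic_resP : `[< coherent p padic_res >] }.

HB.instance Definition _ p (pr : prime p) := [isSub for @padic_res p pr].
HB.instance Definition _ p (pr : prime p) := [Choice of padic_int pr by <:].

Section PadicInt.
Variables (p : nat) (pr : prime p).
Implicit Types x y z : padic_int pr.

Lemma padic_intP x y : (forall k, x k = y k) -> x = y.
Proof. by move=> xy; apply/val_inj/funext. Qed.

Lemma padic_coh x : coherent p x.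
Proof. by case: x => x /= /asboolP. Qed.

Lemma padic_expn_gt0 k : (0 < p ^ k)%N.
Proof. by rewrite expn_gt0 prime_gt0. Qed.

Lemma padic_modr x k : (x k %% p ^ k)%N = x k.
Proof. by rewrite -(padic_coh x k) modn_mod. Qed.

Lemma padic_mod_le x j k : (j <= k)%N -> (x k %% p ^ j)%N = x j.
Proof.
move/subnKC <-; elim: (k - j)%N => [|i IHi]; first by rewrite addn0 padic_modr.
by rewrite -IHi addnS -(padic_coh x (j + i)) modn_dvdm ?dvdn_exp2l ?leq_addr.
Qed.

Lemma coherent_mod (f : nat -> nat) :
  (forall k, f k.+1 = f k %[mod p ^ k])%N ->
  `[< coherent p (fun k => f k %% p ^ k)%N >].
Proof.
by move=> fP; apply/asboolP => k; rewrite modn_dvdm ?fP ?dvdn_exp2l.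
Qed.

Fact padic_nat_coh a : `[< coherent p (fun k => a %% p ^ k)%N >].
Proof. exact: (@coherent_mod (fun=> a)). Qed.
Definition padic_nat a : padic_int pr := PadicInt pr (padic_nat_coh a).

Fact padic_add_coh x y :
  `[< coherent p (fun k => (x k + y k) %% p ^ k)%N >].
Proof.
by apply: coherent_mod => k; rewrite -modnDm !padic_coh.
Qed.
Definition padic_add x y : padic_int pr := PadicInt pr (padic_add_coh x y).

Fact padic_mul_coh x y :
  `[< coherent p (fun k => (x k * y k) %% p ^ k)%N >].
Proof.
by apply: coherent_mod => k; rewrite -modnMm !padic_coh.
Qed.
Definition padic_mul x y : padic_int pr := PadicInt pr (padic_mul_coh x y).

Fact padic_opp_coh x :
  `[< coherent p (fun k => (p ^ k - x k) %% p ^ k)%N >].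
Proof.
have lt_x k : (x k <= p ^ k)%N.
  by rewrite -(padic_modr x k) ltnW // ltn_mod padic_expn_gt0.
apply: coherent_mod => k; apply/eqP; rewrite -(eqn_modDr (x k)) subnK //.
rewrite -{1}(padic_coh x k) modnDmr subnK // modnn.
by rewrite -/(dvdn _ _) dvdn_exp2l.
Qed.
Definition padic_opp x : padic_int pr := PadicInt pr (padic_opp_coh x).

Fact padic_addA : associative padic_add.
Proof.
by move=> x y z; apply: padic_intP => k /=; rewrite modnDml modnDmr addnA.
Qed.
Fact padic_addC : commutative padic_add.
Proof. by move=> x y; apply: padic_intP => k /=; rewrite addnC. Qed.
Fact padic_add0 : left_id (padic_nat 0) padic_add.
Proof.
by move=> x; apply: padic_intP => k /=; rewrite mod0n add0n padic_modr.
Qed.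
Fact padic_addN : left_inverse (padic_nat 0) padic_opp padic_add.
Proof.
move=> x; apply: padic_intP => k /=; rewrite modnDml subnK ?modnn ?mod0n //.
by rewrite -(padic_modr x k) ltnW // ltn_mod padic_expn_gt0.
Qed.

HB.instance Definition _ := GRing.isZmodule.Build (padic_int pr)
  padic_addA padic_addC padic_add0 padic_addN.

Fact padic_mulA : associative padic_mul.
Proof.
by move=> x y z; apply: padic_intP => k /=; rewrite modnMml modnMmr mulnA.
Qed.
Fact padic_mulC : commutative padic_mul.
Proof. by move=> x y; apply: padic_intP => k /=; rewrite mulnC. Qed.
Fact padic_mul1 : left_id (padic_nat 1) padic_mul.
Proof.
by move=> x; apply: padic_intP => k /=; rewrite modnMml mul1n padic_modr.
Qed.
Fact padic_mulDl : left_distributive padic_mul padic_add.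
Proof.
by move=> x y z; apply: padic_intP => k /=; rewrite modnMml modnDm mulnDl.
Qed.
Fact padic_one_neq0 : padic_nat 1 != 0.
Proof.
apply/eqP => /(congr1 (fun x : padic_int pr => x 1%N)) /=.
by rewrite mod0n modn_small // expn1 prime_gt1.
Qed.

HB.instance Definition _ := GRing.Zmodule_isComNzRing.Build (padic_int pr)
  padic_mulA padic_mulC padic_mul1 padic_mulDl padic_one_neq0.

Definition padic_unit : pred (padic_int pr) :=
  fun x => `[< exists y, y * x = 1 >].
Definition padic_inv x : padic_int pr :=
  if pselect (exists y, y * x = 1) is left ex then projT1 (cid ex) else x.

Fact padic_mulV : {in padic_unit, left_inverse 1 padic_inv *%R}.
Proof.
move=> x /asboolP ux; rewrite /padic_inv.
by case: pselect => // ex; case: cid.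
Qed.
Fact padic_unitP x y : y * x = 1 -> padic_unit x.
Proof. by move=> yx; apply/asboolP; exists y. Qed.
Fact padic_inv_out : {in [predC padic_unit], padic_inv =1 id}.
Proof.
by move=> x /asboolPn ux; rewrite /padic_inv; case: pselect.
Qed.

HB.instance Definition _ := GRing.ComNzRing_hasMulInverse.Build (padic_int pr)
  padic_mulV padic_unitP padic_inv_out.

Lemma padic_neq0 x : x != 0 -> exists k, x k <> 0%N.
Proof.
move=> x0; apply: contrapT => /forallNP xk; case/eqP: x0.
by apply: padic_intP => k /=; rewrite mod0n; apply: contrapT.
Qed.

Fact padic_integral x y : x * y = 0 -> (x == 0) || (y == 0).
Proof.
move=> xy0; rewrite -[_ || _]negbK negb_or; apply/negP.
case/andP => /padic_neq0[j xj] /padic_neq0[k yk].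
have xN : (x (j + k)%N %% p ^ j)%N = x j by rewrite padic_mod_le ?leq_addr.
have yN : (y (j + k)%N %% p ^ k)%N = y k by rewrite padic_mod_le ?leq_addl.
have x_gt0 : (0 < x (j + k))%N.
  by rewrite lt0n; apply/eqP => e; move: xN; rewrite e mod0n => /esym.
have y_gt0 : (0 < y (j + k))%N.
  by rewrite lt0n; apply/eqP => e; move: yN; rewrite e mod0n => /esym.
have : (p ^ (j + k) %| x (j + k) * y (j + k))%N.
  have /= := congr1 (fun z : padic_int pr => z (j + k)%N) xy0.
  by rewrite mod0n => /eqP.
rewrite pfactor_dvdn ?muln_gt0 ?x_gt0 // lognM // leqNgt => /negP; apply.
have lx : (logn p (x (j + k)) < j)%N.
  by rewrite ltnNge -pfactor_dvdn //; apply/negP => /eqP; rewrite xN.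
have ly : (logn p (y (j + k)) < k)%N.
  by rewrite ltnNge -pfactor_dvdn //; apply/negP => /eqP; rewrite yN.
by rewrite -addSn leq_add // ltnW.
Qed.

HB.instance Definition _ :=
  GRing.ComUnitRing_isIntegral.Build (padic_int pr) padic_integral.

Lemma padic_natE a : a%:R = padic_nat a :> padic_int pr.
Proof.
apply: padic_intP; elim: a => [|a IHa] k //.
by rewrite mulrS /= IHa modnDm.
Qed.

Lemma padic_natr_eq0 a : (a%:R == 0 :> padic_int pr) = (a == 0)%N.
Proof.
apply/eqP/eqP => [|-> //]; rewrite padic_natE.
move/(congr1 (fun x : padic_int pr => x a)) => /=.
by rewrite mod0n modn_small // ltn_expl // prime_gt1.
Qed.

End PadicInt.

Definition Qp (p : nat) (pr : prime p) : fieldType := {fraction (padic_int pr)}.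

Section RatToQp.
Variables (p : nat) (pr : prime p).

Lemma Qp_intr_eq0 (a : int) : (a%:~R == 0 :> Qp pr) = (a == 0).
Proof.
have natr0 b : (b%:R == 0 :> Qp pr) = (b == 0)%N.
  by rewrite -(rmorph_nat (@FracField.tofrac (padic_int pr))) tofrac_eq0
             padic_natr_eq0.
case: a => a; first by rewrite -pmulrn natr0.
by rewrite NegzE rmorphN /= oppr_eq0 -pmulrn natr0.
Qed.

Definition rat_to_Qp (q : rat) : Qp pr := (numq q)%:~R / (denq q)%:~R.

Lemma rat_to_Qp_frac (a b : int) :
  b != 0 -> rat_to_Qp (a%:~R / b%:~R) = a%:~R / b%:~R.
Proof.
move=> b0; set q := a%:~R / b%:~R.
apply/eqP; rewrite /rat_to_Qp eqr_div ?Qp_intr_eq0 ?denq_eq0 //.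
rewrite -!intrM; apply/eqP; congr _%:~R; apply/eqP.
rewrite -(eqr_int rat) !intrM -eqr_div ?intr_eq0 ?denq_eq0 //.
by rewrite divq_num_den.
Qed.

Fact rat_to_Qp_zmod_morphism : zmod_morphism rat_to_Qp.
Proof.
move=> x y; have dx := denq_neq0 x; have dy := denq_neq0 y.
have nz (F : fieldType) (a b c d : F) : b != 0 -> d != 0 ->
    a / b - c / d = (a * d - c * b) / (b * d).
  by move=> b0 d0; rewrite -mulNr addf_div // mulNr.
rewrite -{1}[x]divq_num_den -{1}[y]divq_num_den nz ?intr_eq0 //.
rewrite -!intrM -intrB rat_to_Qp_frac ?mulf_neq0 //.
by rewrite intrB !intrM -nz ?Qp_intr_eq0.
Qed.

Fact rat_to_Qp_monoid_morphism : monoid_morphism rat_to_Qp.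
Proof.
split; first by rewrite /rat_to_Qp divr1.
move=> x y; rewrite -{1}[x]divq_num_den -{1}[y]divq_num_den mulf_div.
rewrite -!intrM rat_to_Qp_frac ?mulf_neq0 ?denq_neq0 //.
by rewrite /rat_to_Qp mulf_div !intrM.
Qed.

HB.instance Definition _ :=
  GRing.isZmodMorphism.Build rat (Qp pr) rat_to_Qp rat_to_Qp_zmod_morphism.
HB.instance Definition _ :=
  GRing.isMonoidMorphism.Build rat (Qp pr) rat_to_Qp rat_to_Qp_monoid_morphism.

End RatToQp.

Definition ratfun (F : fieldType) (n : nat) : fieldType :=
  {fraction {mpoly F[n]}}.

Section RatfunMap.
Variables (F K : fieldType) (sigma : {rmorphism F -> K}) (n : nat).
Local Notation "x %:F" := (FracField.tofrac x).
Local Notation map := (@map_mpoly n F K sigma).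

(* The coefficientwise embedding F(t_1,...,t_n) -> K(t_1,...,t_n). *)
Definition ratfun_map (f : ratfun F n) : ratfun K n :=
  (map \n_(repr f))%:F / (map \d_(repr f))%:F.

Lemma map_mpoly_eq0 (u : {mpoly F[n]}) : (map u == 0) = (u == 0).
Proof.
apply/eqP/eqP => [u0|->]; last by rewrite raddf0.
apply/mpolyP => m; apply: (fmorph_inj sigma).
by rewrite -mcoeff_map_mpoly u0 !mcoeff0 rmorph0.
Qed.

Lemma ratfun_repr (f : ratfun F n) :
  f = (\n_(repr f))%:F / (\d_(repr f))%:F.
Proof.
have d0 : (\d_(repr f))%:F != 0 by rewrite tofrac_eq0 denom_ratioP.
apply: (mulIf d0); rewrite divfK // -{1}[f]reprK; move: (repr f) => r.
unlock FracField.tofrac; rewrite -[LHS]FracField.pi_mul; apply/eqmodP.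
rewrite /= FracField.equivfE /FracField.mulf.
rewrite !numden_Ratio ?mulf_neq0 ?oner_neq0 ?denom_ratioP //.
by rewrite !mulr1 mulrC.
Qed.

Lemma ratfun_map_frac (a b : {mpoly F[n]}) :
  b != 0 -> ratfun_map (a%:F / b%:F) = (map a)%:F / (map b)%:F.
Proof.
move=> b0; set f := a%:F / b%:F; have d0 := denom_ratioP (repr f).
apply/eqP; rewrite /ratfun_map eqr_div ?tofrac_eq0 ?map_mpoly_eq0 //.
rewrite -!rmorphM /= tofrac_eq; apply/eqP; congr (map _); apply/eqP.
rewrite -tofrac_eq !rmorphM /= -eqr_div ?tofrac_eq0 //.
by rewrite -ratfun_repr.
Qed.

Lemma ratfun_map_poly (a : {mpoly F[n]}) : ratfun_map a%:F = (map a)%:F.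
Proof.
rewrite -[a%:F]divr1 -(rmorph1 (@FracField.tofrac {mpoly F[n]})).
by rewrite ratfun_map_frac ?oner_neq0 // !rmorph1 divr1.
Qed.

Fact ratfun_map_zmod_morphism : zmod_morphism ratfun_map.
Proof.
move=> x y; have dx := denom_ratioP (repr x); have dy := denom_ratioP (repr y).
have sub_div (L : fieldType) (a b c d : L) : b != 0 -> d != 0 ->
    a / b - c / d = (a * d - c * b) / (b * d).
  by move=> b0 d0; rewrite -mulNr addf_div // mulNr.
rewrite {1}[x]ratfun_repr {1}[y]ratfun_repr sub_div ?tofrac_eq0 //.
rewrite -!rmorphM -rmorphB ratfun_map_frac ?mulf_neq0 //.
by rewrite rmorphB !rmorphM rmorphB !rmorphM -sub_div
           ?tofrac_eq0 ?map_mpoly_eq0.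
Qed.

Fact ratfun_map_monoid_morphism : monoid_morphism ratfun_map.
Proof.
split.
  by rewrite -(rmorph1 (@FracField.tofrac {mpoly F[n]})) ratfun_map_poly !rmorph1.
move=> x y; have dx := denom_ratioP (repr x); have dy := denom_ratioP (repr y).
rewrite {1}[x]ratfun_repr {1}[y]ratfun_repr mulf_div.
rewrite -!rmorphM ratfun_map_frac ?mulf_neq0 //.
by rewrite !rmorphM -mulf_div.
Qed.

HB.instance Definition _ := GRing.isZmodMorphism.Build
  (ratfun F n) (ratfun K n) ratfun_map ratfun_map_zmod_morphism.
HB.instance Definition _ := GRing.isMonoidMorphism.Build
  (ratfun F n) (ratfun K n) ratfun_map ratfun_map_monoid_morphism.

End RatfunMap.

Arguments ratfun_map {F K} sigma n f.

Definition isotropic_over (F L : fieldType) (iota : {rmorphism F -> L})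
    (m : nat) (phi : {mpoly F[m]}) : Prop :=
  exists v : 'I_m -> L,
    (exists i, v i != 0) /\ (map_mpoly iota phi).@[v] = 0.

Arguments isotropic_over {F} L iota {m} phi.

(* Main.v *)
(** Clear denominators and substitute for each variable a polynomial in t of
    large degree with unknown coefficients (Lang, Nagata): a zero of the form
    is then the same as a zero of finitely many forms of degree d with integer
    coefficients, whose number times d is less than the number of unknowns.  By
    Chevalley-Warning this system has a nontrivial zero over every F_p.

    It remains to lift these zeros to Z_p for almost all p.  If this failed for
    infinitely many p, take a non-principal ultrafilter on those.  The
    ultraproduct of the F_p has characteristic 0, so any finite tuple x in it
    lifts to a tuple y over the ultraproduct of the Z_p satisfying the same
    integral polynomial relations: coordinates transcendental over the previous
    ones are lifted arbitrarily, algebraic ones by Hensel's lemma applied to a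
    relation of minimal degree, of which they are simple roots.  The
    ultraproducts themselves are never formed: equations are only required to
    hold on a set of the ultrafilter. *)

From HB Require Import structures.
Require Import Defs.
From mathcomp Require Import all_boot all_algebra fraction finfield.
From mathcomp Require Import boolp classical_sets filter mpoly ring zify.

Set Implicit Arguments.
Unset Strict Implicit.
Unset Printing Implicit Defensive.

Import GRing.Theory.
Local Open Scope ring_scope.

(** * Evaluation of polynomials and ring morphisms *)

Lemma mmap_rmorph (A : nzRingType) (B C : comNzRingType) (f : {rmorphism B -> C})
    (g : A -> B) N (v : 'I_N -> B) (p : {mpoly A[N]}) :
  f (mmap g v p) = mmap (f \o g) (f \o v) p.
Proof.
rewrite /mmap rmorph_sum; apply: eq_bigr => m _.
rewrite rmorphM rmorph_prod; congr (_ * _).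
by apply: eq_bigr => i _; rewrite rmorphXn.
Qed.

Lemma mmap_intr_rmorph (B C : comNzRingType) (f : {rmorphism B -> C}) N
    (v : 'I_N -> B) (g : {mpoly int[N]}) :
  f (mmap intr v g) = mmap intr (f \o v) g.
Proof.
rewrite mmap_rmorph; congr (mmap _ _ _); apply/funext => c /=.
exact: rmorph_int.
Qed.

Lemma mmap_map_mpoly (A B C : nzRingType) (f : {rmorphism A -> B})
    (g : {rmorphism B -> C}) N (v : 'I_N -> C) (p : {mpoly A[N]}) :
  mmap g v (map_mpoly f p) = mmap (g \o f) v p.
Proof.
rewrite [in RHS]/mmap raddf_sum; apply: eq_bigr => m _ /=.
by rewrite mmap1_id mul_mpolyC mmapZ mmapX.
Qed.

Lemma map_mpoly_intr (A B : nzRingType) (g : {rmorphism A -> B}) n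
    (f : {mpoly int[n]}) :
  map_mpoly g (map_mpoly intr f) = map_mpoly intr f.
Proof. by apply/mpolyP => b; rewrite !mcoeff_map_mpoly; exact: rmorph_int. Qed.

Lemma map_mpoly_inj_eq0 n (A B : nzRingType) (f : {rmorphism A -> B})
    (p : {mpoly A[n]}) : injective f -> (map_mpoly f p == 0) = (p == 0).
Proof.
move=> f_inj; apply/eqP/eqP => [p0|->]; last by rewrite raddf0.
apply/mpolyP => m; apply: f_inj.
by rewrite -mcoeff_map_mpoly p0 !mcoeff0 rmorph0.
Qed.

(** * Lifting zeros from residue fields along an ultrafilter *)

Section UltrafilterLifting.
Variables (I : Type) (U : set_system I).
Context {UU : UltraFilter U}.
Variables (R : I -> idomainType) (k : I -> fieldType).
Variable res : forall i, {rmorphism R i -> k i}.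
Arguments res : clear implicits.
Hypothesis res_surj : forall i x, exists y, res i y = x.
Hypothesis hensel : forall i (g : {poly R i}) a,
  res i g.[a] = 0 -> res i g^`().[a] != 0 ->
  exists2 b, g.[b] = 0 & res i b = res i a.
Hypothesis char0 : forall n, U (fun i => n.+1%:R != 0 :> k i).

Lemma ultra_notP (P : I -> Prop) : ~ U P <-> U (fun i => ~ P i).
Proof.
split=> [nUP | UnP UP]; first by have [] := in_ultra_setVsetC P UU.
by have [] := @filter_ex _ U _ _ (filterI UP UnP) => i [].
Qed.

(** In terms of ultraproducts: on the image of [A] in the ultraproduct of the [R i], reduction to
    the ultraproduct of the [k i] is injective. *)
Definition reflects_zeros (A : comNzRingType)
    (a : forall i, {rmorphism A -> R i}) :=
  forall g, U (fun i => res i (a i g) = 0) -> U (fun i => a i g = 0).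

Definition extend_eval (A : comNzRingType) (a : forall i, {rmorphism A -> R i})
    (y : forall i, R i) i : {rmorphism {poly A} -> R i} :=
  horner_eval (y i) \o map_poly (a i).
Arguments extend_eval [A] a y i.

Lemma res_horner_eq (i : I) (g : {poly R i}) a b :
  res i a = res i b -> res i g.[a] = res i g.[b].
Proof. by move=> ab; rewrite -!horner_map ab. Qed.

Section Step.
Variables (A : comNzRingType) (a : forall i, {rmorphism A -> R i}).
Hypothesis a_refl : reflects_zeros a.
Variable z : forall i, R i.

Let vanishes (g : {poly A}) := U (fun i => res i (extend_eval a z i g) = 0).

Lemma vanishing_poly_eq0 s :
    (forall g : {poly A}, (size g <= s)%N -> vanishes g ->
       U (fun i => res i (a i (lead_coef g)) = 0)) ->
  forall g : {poly A}, (size g <= s)%N -> vanishes g ->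
    U (fun i => map_poly (a i) g = 0).
Proof.
elim: s => [|s IHs] lead0 g gs g0.
  move: gs; rewrite leqn0 size_poly_eq0 => /eqP->.
  by apply: filterS filterT => i _; rewrite rmorph0.
have {}IHs := IHs (fun g gs => lead0 g (leqW gs)).
have [gs'|gs'] := leqP (size g) s; first exact: IHs.
have gS : size g = s.+1 by apply/eqP; rewrite eqn_leq gs.
have l0 := a_refl (lead0 g gs g0).
pose h := g - (lead_coef g)%:P * 'X^s.
have hs : (size h <= s)%N.
  apply/leq_sizeP => j; rewrite leq_eqVlt coefB coefCM coefXn => /orP[/eqP<-|sj].
    by rewrite eqxx mulr1 /lead_coef gS subrr.
  by rewrite gtn_eqF // mulr0 subr0 nth_default // gS.
have gh : g = h + (lead_coef g)%:P * 'X^s by rewrite subrK.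
have Uh : U (fun i => map_poly (a i) g = map_poly (a i) h).
  apply: filterS l0 => i li.
  by rewrite [in LHS]gh rmorphD rmorphM /= map_polyC /= li mul0r addr0.
have /(IHs _ hs) : vanishes h.
  apply: filterS (filterI g0 Uh) => i [].
  by rewrite /extend_eval /= => gi hi; rewrite -hi.
by move=> h0; apply: filterS (filterI h0 Uh) => i [<-].
Qed.

(** Adjoins one coordinate. A relation is good if it vanishes at [z] while its leading coefficient
    does not vanish residually; a good relation of minimal size plays the role of a minimal
    polynomial of [z] over [A]. *)
Lemma reflects_zeros_extend :
  exists2 y : forall i, R i, (forall i, res i (y i) = res i (z i)) &
    reflects_zeros (extend_eval a y).
Proof.
pose good (g : {poly A}) := vanishes g /\
  U (fun i => res i (a i (lead_coef g)) != 0).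
have nogood g : ~ good g -> vanishes g ->
    U (fun i => res i (a i (lead_coef g)) = 0).
  move=> ng g0; apply: contrapT => /ultra_notP nl; apply: ng; split=> //.
  by apply: filterS nl => i /eqP.
have eval_res y (yz : forall i, res i (y i) = res i (z i)) g i :
    res i (extend_eval a y i g) = res i (extend_eval a z i g).
  exact: res_horner_eq.
(* Without a good relation [z] is transcendental over [A]: every polynomial vanishing at [z] has
   zero image, so [z] itself serves as [y]. *)
have [[g0 gg0]|ng] := pselect (exists g, good g); last first.
  exists z => // g g0.
  have/(_ g) g_eq0 := @vanishing_poly_eq0 (size g)
    (fun h _ => nogood h (fun gh => ng (ex_intro _ h gh))).
  apply: filterS (g_eq0 (leqnn _) g0) => i.
  by rewrite /extend_eval /= => ->; rewrite rmorph0.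
have ex_s : exists s, `[< exists2 g, good g & size g = s >].
  by exists (size g0); apply/asboolP; exists g0.
have [s /asboolP[g [g_van g_lead] gs] smin] := ex_minnP ex_s.
have small (h : {poly A}) : (size h < s)%N -> vanishes h ->
    U (fun i => map_poly (a i) h = 0).
  move=> hs; apply: (@vanishing_poly_eq0 s.-1); last by case: s hs {gs smin}.
  move=> f fs; apply: nogood => gf.
  have : (s <= size f)%N by apply: smin; apply/asboolP; exists f.
  by case: s hs fs {gs smin} => // s _ fs /leq_trans/(_ fs); rewrite ltnn.
(* A constant [g] would equal its leading coefficient, which would have to vanish and not to
   vanish. *)
have s_gt1 : (1 < s)%N.
  rewrite ltnNge -gs; apply/negP => /size1_polyC gC.
  suff /ultra_notP : U (fun i => ~ res i (a i (lead_coef g)) = 0).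
    apply; apply: filterS g_van => i.
    by rewrite gC lead_coefC /extend_eval /= map_polyC /horner_eval hornerC.
  by apply: filterS g_lead => i /eqP.
have g_neq0 : g != 0 by rewrite -size_poly_gt0 gs ltnW.
(* The derivative is shorter than [g], so if it vanished at [z] its image would be zero by
   minimality. But its coefficient of index s - 2 is s - 1 times the leading coefficient of [g],
   nonzero by [char0]. *)
have g'_neq0 : U (fun i => res i (extend_eval a z i g^`()) != 0).
  suff : ~ vanishes g^`().
    by move/ultra_notP; apply: filterS => i /eqP.
  move=> g'0.
  have g's : (size g^`() < s)%N by rewrite -gs lt_size_deriv.
  have [i [[g'i0 li] ci]] :=
    filter_ex (filterI (filterI (small _ g's g'0) g_lead) (char0 s.-2)).
  have := congr1 (fun f : {poly R i} => res i f`_s.-2) g'i0.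
  rewrite coef_map coef_deriv coef0 rmorph0 !raddfMn /=.
  have -> : s.-2.+1 = s.-1 by case: s s_gt1 {ci gs small smin g's} => [|[]].
  rewrite -gs -/(lead_coef g) -mulr_natr => /eqP.
  rewrite mulf_eq0 (negPf li) /=.
  have -> : (size g).-1 = s.-2.+1.
    by rewrite gs; case: s s_gt1 {ci gs small smin g's} => [|[]].
  by rewrite (negPf ci).
(* The lift is needed at every index; where Hensel's lemma does not apply, the default is [z i]. *)
have lift i : {y | res i y = res i (z i) /\
    (res i (extend_eval a z i g) = 0 -> res i (extend_eval a z i g^`()) != 0 ->
     (map_poly (a i) g).[y] = 0)}.
  apply: cid.
  have [[gz g'z]|nz] := pselect (res i (extend_eval a z i g) = 0 /\
      res i (extend_eval a z i g^`()) != 0); last first.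
    by exists (z i); split=> // gz g'z; case: nz.
  have [||y gy yz] := @hensel i (map_poly (a i) g) (z i); first exact: gz.
    by rewrite deriv_map.
  by exists y.
pose y i := projT1 (lift i).
have yz i : res i (y i) = res i (z i) by rewrite /y; case: (lift i) => ? [].
have gy : U (fun i => extend_eval a y i g = 0).
  apply: filterS (filterI g_van g'_neq0) => i [gz g'z].
  by rewrite /y /extend_eval /= /horner_eval; case: (lift i) => ? [_ ->].
exists y => // h hy.
have h_van : vanishes h by apply: filterS hy => i; rewrite eval_res.
(* Pseudo-division: a power of the leading coefficient of [g] times [h] is a multiple of [g] plus
   [r]. At [y] both summands vanish, the second by minimality, and the leading coefficient cancels
   since [R i] is a domain. *)
have := Pdiv.ComRing.rdivp_eq g h.
set e := Pdiv.Ring.rscalp _ _; set q := Pdiv.Ring.rdivp _ _.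
set r := Pdiv.Ring.rmodp _ _ => hE.
have rs : (size r < s)%N by rewrite -gs Pdiv.Ring.ltn_rmodp.
have r_van : vanishes r.
  apply: filterS (filterI h_van g_van) => i [hi gi].
  have /(congr1 (fun f => res i (extend_eval a z i f))) := hE.
  rewrite -mul_polyC !(rmorphM, rmorphD) hi gi !mulr0 add0r.
  by move=> <-.
apply: filterS (filterI (filterI gy (small _ rs r_van)) g_lead).
move=> i [[gi ri] li].
have := congr1 (fun f => extend_eval a y i f) hE.
rewrite -mul_polyC !(rmorphM, rmorphD) gi mulr0 add0r.
rewrite /extend_eval /= ri rmorph0 => /eqP.
rewrite map_polyC /= /horner_eval hornerC rmorphXn /= mulf_eq0.
rewrite expf_eq0 => /orP[/andP[_ /eqP l0]|/eqP //].
by rewrite l0 rmorph0 eqxx in li.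
Qed.

End Step.

(** A nonzero integer has nonzero residue on a set of [U], by [char0], so only 0 has to be
    considered. *)
Lemma reflects_zeros_int : reflects_zeros (fun i => intr : {rmorphism int -> R i}).
Proof.
move=> c Uc; have [->|] := eqVneq c 0.
  by apply: filterS filterT => i _; rewrite rmorph0.
case: c Uc => [[//|n]|n] Uc _; have [i []] := filter_ex (filterI Uc (char0 n)).
  by rewrite rmorph_int -pmulrn => ->; rewrite eqxx.
by rewrite rmorph_int NegzE rmorphN /= -pmulrn => /eqP; rewrite oppr_eq0 => ->.
Qed.

(* The lifted coordinates are images of elements of one ring of "generic"
   values, so that integral relations are decided in that ring. *)
Lemma lift_tuple N (x : forall i, 'I_N -> k i) :
  exists (A : comNzRingType) (a : forall i, {rmorphism A -> R i})
         (c : 'I_N -> A),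
    reflects_zeros a /\ forall i j, res i (a i (c j)) = x i j.
Proof.
elim: N x => [|N IHN] x.
  exists int, (fun i => intr : {rmorphism int -> R i}), (fun=> 0).
  split; first exact: reflects_zeros_int.
  by move=> i [].
have [A [a [c [a_refl cx]]]] := IHN (fun i j => x i (fintype.lift ord0 j)).
pose z i := projT1 (cid (res_surj (x i ord0))).
have [y yz y_refl] := reflects_zeros_extend a_refl z.
exists {poly A}, (extend_eval a y).
exists (fun j : 'I_N.+1 => if unlift ord0 j is Some j' then (c j')%:P else 'X).
split=> // i j; case: unliftP => [j' ->|->].
  by rewrite /extend_eval /= map_polyC /horner_eval hornerC cx.
rewrite /extend_eval /= map_polyX /horner_eval hornerX yz /z.
by case: cid.
Qed.

(** The value of [g] at the generic point [c] is a single element of [A]; it maps to the value at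
    [y i] in [R i] and to the value at [x i] in [k i]. *)
Lemma lift_zeros N (x : forall i, 'I_N -> k i) :
  exists2 y : forall i, 'I_N -> R i, forall i j, res i (y i j) = x i j &
    forall g : {mpoly int[N]}, U (fun i => mmap intr (x i) g = 0) ->
      U (fun i => mmap intr (y i) g = 0).
Proof.
have [A [a [c [a_refl cx]]]] := lift_tuple x.
exists (fun i => a i \o c) => // g gx.
have g0 : U (fun i => res i (a i (mmap intr c g)) = 0).
  apply: filterS gx => i; rewrite !mmap_intr_rmorph => <-; congr (mmap _ _ _).
  by apply/funext => j; rewrite -cx.
by apply: filterS (a_refl _ g0) => i; rewrite mmap_intr_rmorph.
Qed.

End UltrafilterLifting.

(** * Residues and Hensel's lemma for the p-adic integers *)

Lemma horner_taylor2 (R : comNzRingType) (g : {poly R}) (b h : R) :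
  exists c, g.[b + h] = g.[b] + g^`().[b] * h + c * h ^+ 2.
Proof.
elim/poly_ind: g => [|g e [c IH]].
  by exists 0; rewrite deriv0 !horner0 !mul0r !addr0.
exists (g^`().[b] + c * (b + h)).
rewrite derivD derivM derivX derivC addr0 mulr1.
rewrite !(hornerD, hornerM, hornerX, hornerC) IH.
by ring.
Qed.

Section Padic.
Variables (p : nat) (pr : prime p).
Implicit Types x y : padic_int pr.

Lemma padic_res_lt x k : (x k < p ^ k)%N.
Proof. by rewrite -padic_modr ltn_mod padic_expn_gt0. Qed.

Lemma padic_res0 x : x 0%N = 0%N.
Proof. by have := padic_res_lt x 0; case: (x 0%N). Qed.

Lemma padic_zeroE k : (0 : padic_int pr) k = 0%N.
Proof. exact: mod0n. Qed.

Lemma padic_addE x y k : (x + y) k = ((x k + y k) %% p ^ k)%N.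
Proof. by []. Qed.

Lemma padic_mulE x y k : (x * y) k = ((x k * y k) %% p ^ k)%N.
Proof. by []. Qed.

Lemma padic_subr_eq0 x y k : (x - y) k = 0%N <-> x k = y k.
Proof.
have add0 (z w : padic_int pr) : z k = 0%N -> (z + w) k = w k.
  by rewrite padic_addE => ->; rewrite add0n padic_modr.
split=> [xy0|xy]; first by rewrite -[in LHS](subrK y x) add0.
by rewrite padic_addE xy -padic_addE subrr padic_zeroE.
Qed.

Lemma padic_res_dvd x j k : (j <= k)%N -> x j = 0%N -> (p ^ j %| x k)%N.
Proof. by move=> jk xj; rewrite /dvdn padic_mod_le // xj. Qed.

(** Since [x j = 0] means that p^j divides [x], this says that lower bounds on valuations add up. *)
Lemma padic_mul_res0 x y j k :
  x j = 0%N -> y k = 0%N -> (x * y) (j + k)%N = 0%N.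
Proof.
move=> xj yk; apply/eqP; rewrite padic_mulE -/(dvdn _ _) expnD.
by rewrite dvdn_mul // padic_res_dvd ?leq_addr ?leq_addl.
Qed.

Lemma padic_mul_res0r x y k : y k = 0%N -> (x * y) k = 0%N.
Proof. exact: (@padic_mul_res0 x y 0 k (padic_res0 x)). Qed.

Lemma padic_add_res0 x y k : x k = 0%N -> y k = 0%N -> (x + y) k = 0%N.
Proof. by rewrite padic_addE => -> ->; rewrite mod0n. Qed.

Lemma padic_res0_le x j k : (j <= k)%N -> x k = 0%N -> x j = 0%N.
Proof. by move=> jk xk; rewrite -(padic_mod_le x jk) xk mod0n. Qed.

Definition padic_residue x : 'F_p := (x 1%N)%:R.

Lemma natr_modX1 a : (a %% p ^ 1)%N%:R = a%:R :> 'F_p.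
Proof. by rewrite expn1 Fp_nat_mod. Qed.

Fact padic_residue_zmod_morphism : zmod_morphism padic_residue.
Proof.
move=> x y; apply/eqP; rewrite eq_sym subr_eq -natrD -[X in _ == X]natr_modX1.
by rewrite -padic_addE subrK.
Qed.
Fact padic_residue_monoid_morphism : monoid_morphism padic_residue.
Proof.
split=> [|x y]; last by rewrite -natrM -natr_modX1.
by rewrite /padic_residue /= modn_small // expn1 prime_gt1.
Qed.
HB.instance Definition _ := GRing.isZmodMorphism.Build
  (padic_int pr) 'F_p padic_residue padic_residue_zmod_morphism.
HB.instance Definition _ := GRing.isMonoidMorphism.Build
  (padic_int pr) 'F_p padic_residue padic_residue_monoid_morphism.

Lemma padic_residue_eq0 x : (padic_residue x == 0) = (x 1%N == 0%N).
Proof.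
rewrite -(dvdn_pcharf (pchar_Fp pr)) /dvdn modn_small //.
by have := padic_res_lt x 1; rewrite expn1.
Qed.

Lemma padic_residue_surj (a : 'F_p) : exists x, padic_residue x = a.
Proof. by exists (a : nat)%:R; rewrite rmorph_nat natr_Zp. Qed.

Lemma padic_limit (b : nat -> padic_int pr) :
  (forall k, b k.+1 k = b k k) -> exists x, forall k, x k = b k k.
Proof.
move=> bP; have coh : `[< coherent p (fun k => b k k) >].
  by apply/asboolP => k; rewrite padic_coh.
by exists (PadicInt pr coh).
Qed.

(* Newton iteration with the fixed slope [u], an inverse of [g'(a)] modulo p,
   gains one power of p at each step. *)
Lemma padic_hensel (g : {poly padic_int pr}) (a : padic_int pr) :
  padic_residue g.[a] = 0 -> padic_residue g^`().[a] != 0 ->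
  exists2 b, g.[b] = 0 & padic_residue b = padic_residue a.
Proof.
move=> ga g'a; have [u uE] := padic_residue_surj (padic_residue g^`().[a])^-1.
pose b k := iter k (fun x => x - u * g.[x]) a.
have bS k : b k.+1 = b k - u * g.[b k] by [].
have main k : padic_residue (b k) = padic_residue a /\ g.[b k] k.+1 = 0%N.
  elim: k => [|k [ba gb]].
    by split=> //; apply/eqP; rewrite -padic_residue_eq0 ga.
  have gb1 : padic_residue g.[b k] = 0.
    by apply/eqP; rewrite padic_residue_eq0; apply/eqP; apply: padic_res0_le gb.
  split; first by rewrite bS rmorphB rmorphM /= gb1 mulr0 subr0.
  have [c ->] := horner_taylor2 g (b k) (- (u * g.[b k])).
  (* In the first summand 1 - u g'(b) is divisible by p and g(b) by p^(k+1); the second is divisible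
     by p^(2k+2). *)
  have -> : g.[b k] + g^`().[b k] * - (u * g.[b k]) + c * (- (u * g.[b k])) ^+ 2
      = (1 - u * g^`().[b k]) * g.[b k] + (c * u ^+ 2) * (g.[b k] * g.[b k]).
    rewrite sqrrN exprMn mulrBl mul1r mulrN mulrA [_ * u]mulrC expr2 !mulrA.
    by rewrite [c * u * u * _ * _]mulrAC.
  apply: padic_add_res0; last first.
    apply/padic_mul_res0r/(@padic_res0_le _ _ (k.+1 + k.+1)%N).
      by rewrite addSn addnS !ltnS leq_addr.
    exact: padic_mul_res0.
  rewrite -[k.+2]add1n; apply: padic_mul_res0 => //.
  apply/eqP; rewrite -padic_residue_eq0 rmorphB rmorphM rmorph1 /= uE.
  have -> : padic_residue g^`().[b k] = padic_residue g^`().[a].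
    by rewrite -!(horner_map (padic_residue : {rmorphism padic_int pr -> 'F_p})) /= ba.
  by rewrite mulVf // subrr.
have [|y yE] := @padic_limit b.
  move=> k; apply/padic_subr_eq0; rewrite bS addrAC subrr add0r -mulNr.
  by apply/padic_mul_res0r/(padic_res0_le (leqnSn k)); case: (main k).
exists y.
  apply: padic_intP => k; rewrite padic_zeroE.
  have [_ /(padic_res0_le (leqnSn k)) gk] := main k.
  (* Modulo p^k the limit [y] agrees with [b k], so g(y) is congruent to g(b k), which is 0. *)
  have [c] := horner_taylor2 g (b k) (y - b k).
  rewrite addrC subrK => ->.
  have yb : (y - b k) k = 0%N by apply/padic_subr_eq0.
  apply: padic_add_res0; last by rewrite expr2 mulrA; apply: padic_mul_res0r.
  by apply: padic_add_res0 => //; apply: padic_mul_res0r.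
by have [<- _] := main 1%N; rewrite /padic_residue yE.
Qed.

End Padic.

(** * The Chevalley-Warning theorem *)

(** For k = 0, the translation by 1 permutes [F], so the sum of all ones is 0. For k > 0, X^k - 1
    has too few roots to kill all units, and scaling by a non-root [g] multiplies the sum by g^k,
    distinct from 1. *)
Lemma sum_exp_finField (F : finFieldType) k :
  (k < #|F|.-1)%N -> \sum_(a : F) a ^+ k = 0.
Proof.
case: k => [_|k kF].
  have : \sum_(a : F) a = \sum_(a : F) a + \sum_(a : F) a ^+ 0.
    rewrite -big_split [LHS](reindex_inj (addIr 1)); exact: eq_bigr.
  by rewrite -[LHS]addr0 => /addrI <-.
have [g g0 gk] : exists2 g : F, g != 0 & g ^+ k.+1 != 1.
  apply/exists_inP; apply: contraLR kF => /exists_inPn gP.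
  rewrite -leqNgt -ltnS -(size_XnsubC (1 : F) (ltn0Sn k)).
  have := @max_poly_roots _ ('X^(k.+1) - 1%:P) (enum [pred a : F | a != 0]).
  rewrite -cardE cardC1; apply.
  - by rewrite -size_poly_gt0 size_XnsubC.
  - apply/allP => a; rewrite mem_enum => /gP; rewrite negbK.
    by rewrite rootE !hornerE subr_eq0.
  - exact: enum_uniq.
have gS : g ^+ k.+1 * \sum_(a : F) a ^+ k.+1 = \sum_(a : F) a ^+ k.+1.
  rewrite mulr_sumr [RHS](reindex_inj (mulfI g0)).
  by apply: eq_bigr => a _; rewrite exprMn.
apply/eqP; move/eqP: gS; rewrite -{2}[\sum_a _]mul1r -subr_eq0 -mulrBl.
by rewrite mulf_eq0 subr_eq0 (negPf gk).
Qed.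

Section ChevalleyWarning.
Variables (F : finFieldType) (N : nat).

(** As [msize] is the degree plus one, each monomial has some exponent below |F| - 1. Its sum over
    all points is a product of power sums, one of them zero. *)
Lemma meval_sum_eq0 (P : {mpoly F[N]}) :
  (msize P <= N * #|F|.-1)%N -> \sum_(x : {ffun 'I_N -> F}) P.@[x] = 0.
Proof.
move=> Ps; under eq_bigr do rewrite mevalE; rewrite exchange_big /=.
rewrite big_seq big1 // => m mP; rewrite -mulr_sumr.
rewrite -(bigA_distr_bigA (fun i a => a ^+ m i)) /=.
have [i mi] : exists i, (m i < #|F|.-1)%N.
  apply/existsP; apply: contraLR (leq_trans (msize_mdeg_lt mP) Ps).
  move/existsPn => mi; rewrite -leqNgt mdegE -[X in (X * _)%N]card_ord.
  by rewrite -sum_nat_const leq_sum // => i _; rewrite leqNgt.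
by rewrite (bigD1 i) //= sum_exp_finField // mul0r mulr0.
Qed.

Lemma msizeM_leS (P Q : {mpoly F[N]}) a b :
  (msize P <= a.+1)%N -> (msize Q <= b.+1)%N -> (msize (P * Q) <= (a + b).+1)%N.
Proof.
have [->|P0] := eqVneq P 0; first by rewrite mul0r msize0.
have [->|Q0] := eqVneq Q 0; first by rewrite mulr0 msize0.
move=> Pa Qb; rewrite msizeM // -subn1 leq_subLR add1n -addSn -addnS.
exact: leq_add.
Qed.

Lemma msize_exp_le (P : {mpoly F[N]}) d e :
  (msize P <= d.+1)%N -> (msize (P ^+ e) <= (e * d).+1)%N.
Proof.
move=> Pd; elim: e => [|e IHe]; first by rewrite expr0 msize1.
by rewrite exprS mulSn; apply: msizeM_leS.
Qed.

Lemma Chevalley_Warning (J : finType) (G : J -> {mpoly F[N]}) d :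
    (forall j, msize (G j) <= d.+1)%N -> (forall j, (G j).@[fun=> 0] = 0) ->
    (d * #|J| < N)%N ->
  exists x : 'I_N -> F, (exists i, x i != 0) /\ forall j, (G j).@[x] = 0.
Proof.
move=> Gd G0 dN; set q := #|F|.-1.
have q_gt0 : (0 < q)%N by rewrite -ltnS prednK ?finNzRing_gt1 // ltnW ?finNzRing_gt1.
(* With q = |F| - 1, this is the indicator function of the set of common zeros. *)
pose P := \prod_j (1 - G j ^+ q).
have Ps : (msize P <= N * q)%N.
  suff : (msize P <= (d * #|J| * q).+1)%N.
    by move/leq_trans; apply; rewrite ltn_mul2r q_gt0.
  rewrite mulnAC mulnC cardT /P -big_enum /=.
  elim: (enum J) => [|j s IHs]; first by rewrite big_nil msize1.
  rewrite big_cons mulSn; apply: msizeM_leS => //.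
  apply: leq_trans (msizeD_le _ _) _; rewrite msize1 msizeN geq_max ltnS leq0n.
  by rewrite mulnC; exact: msize_exp_le.
have PE (x : {ffun 'I_N -> F}) : P.@[x] = [forall j, (G j).@[x] == 0]%:R.
  rewrite /P rmorph_prod /=.
  case: (boolP [forall j, _]) => [/forallP Gx|/forallPn[j Gx]].
    apply: big1 => j _; rewrite rmorphB rmorph1 rmorphXn /= (eqP (Gx j)).
    by rewrite expr0n eqn0Ngt q_gt0 subr0.
  rewrite (bigD1 j) //= rmorphB rmorph1 rmorphXn /=.
  suff -> : (G j).@[x] ^+ q = 1 by rewrite subrr mul0r.
  by apply: (mulfI Gx); rewrite -exprS mulr1 prednK ?expf_card // (cardD1 0).
(* The origin contributes 1 to a sum equal to 0, so there is another common zero. *)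
have := meval_sum_eq0 Ps.
rewrite (bigD1 [ffun=> 0]) //= PE.
have -> : [forall j, (G j).@[[ffun=> 0]] == 0].
  apply/forallP => j; apply/eqP; rewrite -[RHS](G0 j).
  by apply: meval_eq => i; rewrite ffunE.
case: (pickP [pred x : {ffun 'I_N -> F} |
    (x != [ffun=> 0]) && [forall j, (G j).@[x] == 0]]) => [x|nx].
  case/andP => x0 /forallP Gx _; exists x; split=> [|j]; last exact/eqP.
  apply/existsP; apply: contraNT x0 => /existsPn x0.
  by apply/eqP/ffunP => i; rewrite ffunE; apply/eqP; rewrite -[_ == _]negbK.
rewrite big1 => [/eqP|x x0]; first by rewrite addr0 oner_eq0.
by rewrite PE; have := nx x; rewrite inE x0 andTb => ->.
Qed.

End ChevalleyWarning.

(** * The Lang-Nagata substitution *)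

Lemma expn_affine_le d E n : exists C, forall X, (0 < X)%N ->
  ((d * X + E) ^ n.+1 <= (d ^ n.+1 * X + C) * X ^ n)%N.
Proof.
elim: n => [|n [C IH]].
  by exists E => X _; rewrite !expn1 expn0 muln1.
exists (d * C + E * d ^ n.+1 + E * C)%N => X X0.
rewrite expnS (leq_trans (leq_mul (leqnn _) (IH X X0))) //.
rewrite mulnA [(X ^ n.+1)%N]expnS mulnA leq_mul2r [(d ^ n.+2)%N]expnS.
apply/orP; right; move: (d ^ n.+1)%N => f; nia.
Qed.

(** Compares leading terms in X = s + 1: the left side grows like d^(n+1) X^n, the right side is m
    X^n. The lower-order error is at most dC X^(n-1), and s = dC makes X exceed dC. *)
Lemma unknowns_exceed_degree d D n m : (0 < n)%N -> (d ^ n.+1 < m)%N ->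
  exists s, (d * (D + d * s).+1 ^ n < m * s.+1 ^ n)%N.
Proof.
case: n => // n _ dm; have [C CP] := expn_affine_le d D.+1 n.
exists (d * C)%N; set X := (d * C).+1.
have le1 : ((D + d * (d * C)).+1 <= d * X + D.+1)%N by rewrite /X; lia.
apply: (@leq_ltn_trans (d * ((d ^ n.+1 * X + C) * X ^ n))%N).
  rewrite leq_mul2l (leq_trans _ (CP X _)) ?orbT //.
  by rewrite leq_exp2r.
rewrite [(X ^ n.+1)%N]expnS !mulnA ltn_mul2r expn_gt0 /=.
rewrite mulnDr mulnA -expnS (@leq_trans ((d ^ n.+2).+1 * X)%N) ?leq_mul2r ?dm ?orbT //.
by rewrite mulSn addnC ltn_add2r /X.
Qed.

Section BoxDegree.
Variables (K : comNzRingType) (N n : nat).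
Local Notation A := {mpoly K[N]}.

(** Here [e] bounds the degree in each t-variable separately, so that the exponents fill a box with
    (e+1)^n points, while [d] is the degree of the coefficients in the unknowns. *)
Definition box_homog (e d : nat) (P : {mpoly A[n]}) := forall b : 'X_{1..n},
  P@_b \is d.-homog /\ (P@_b != 0 -> forall i, (b i <= e)%N).

Lemma box_homog_sum e d (T : eqType) (r : seq T) (F : T -> {mpoly A[n]}) :
  {in r, forall t, box_homog e d (F t)} -> box_homog e d (\sum_(t <- r) F t).
Proof.
move=> FP b; rewrite raddf_sum big_seq /=; split=> [|nz].
  by apply: rpred_sum => t /FP/(_ b)[].
suff [t tr /(proj2 (FP t tr b))] : exists2 t, t \in r & (F t)@_b != 0 by [].
apply: contrapT => nt; case/eqP: nz; apply: big1 => t tr.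
by apply/eqP; apply: contrapT => /negP ?; apply: nt; exists t.
Qed.

Lemma box_homogM e e' d d' P Q :
  box_homog e d P -> box_homog e' d' Q -> box_homog (e + e') (d + d') (P * Q).
Proof.
move=> HP HQ b; split.
  rewrite mcoeffM; apply: rpred_sum => k _.
  by apply: dhomogM; [have [] := HP k.1 | have [] := HQ k.2].
rewrite -mcoeff_msupp => /msuppM_le/allpairsP[[m1 m2] /= [m1P m2Q ->]] i.
rewrite mnmDE leq_add //; last by have [_] := HQ m2; apply; rewrite -mcoeff_msupp.
by have [_] := HP m1; apply; rewrite -mcoeff_msupp.
Qed.

Lemma box_homog1 : box_homog 0 0 1.
Proof.
move=> b; rewrite mcoeff1; have [->|_] := eqVneq; last by rewrite dhomog0 eqxx.
by rewrite dhomog1; split=> // _ i; rewrite mnm0E.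
Qed.

Lemma box_homogX e d P k : box_homog e d P -> box_homog (k * e) (k * d) (P ^+ k).
Proof.
move=> HP; elim: k => [|k IHk]; first exact: box_homog1.
by rewrite exprS !mulSn; apply: box_homogM.
Qed.

Lemma box_homog_mmap1 e d M (v : 'I_M -> {mpoly A[n]}) (m : 'X_{1..M}) :
  (forall i, box_homog e d (v i)) -> box_homog (mdeg m * e) (mdeg m * d) (mmap1 v m).
Proof.
move=> vP; rewrite mdegE /mmap1.
elim: (index_enum _) => [|i r IHr]; first by rewrite !big_nil; apply: box_homog1.
by rewrite !big_cons !mulnDl; apply: box_homogM => //; apply: box_homogX.
Qed.

End BoxDegree.

Section Box.
Variables (n e : nat).
Definition box_mnm (b : {ffun 'I_n -> 'I_e.+1}) : 'X_{1..n} :=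
  [multinom (b i : nat) | i < n].

Lemma box_mnm_inj : injective box_mnm.
Proof.
move=> b c /mnmP bc; apply/ffunP => i; apply/val_inj.
by have := bc i; rewrite !mnmE.
Qed.

Lemma box_mnmP (b : 'X_{1..n}) : (forall i, (b i <= e)%N) -> exists c, b = box_mnm c.
Proof.
move=> be; exists [ffun i => inord (b i)]; apply/mnmP => i.
by rewrite mnmE ffunE inordK // ltnS.
Qed.
End Box.

Lemma Lang_Nagata_system (d n m : nat) (psi : {mpoly {mpoly int[n]}[m]}) :
    (0 < n)%N -> psi \is d.-homog -> (d ^ n.+1 < m)%N ->
  exists (N : nat) (J : finType) (G : J -> {mpoly int[N]}),
    [/\ forall j, G j \is d.-homog, (d * #|J| < N)%N &
      forall (S : comNzRingType) (y : 'I_N -> S), (exists i, y i != 0) ->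
        (forall j, mmap intr y (G j) = 0) ->
        exists w : 'I_m -> {mpoly S[n]}, (exists i, w i != 0) /\
          mmap (map_mpoly intr) w psi = 0].
Proof.
move=> n0 psi_d dm.
(* Bounds the degree of every coefficient of [psi] in each t-variable. *)
pose D := (\max_(mu <- msupp psi) msize psi@_mu)%N.
have [s sP] := unknowns_exceed_degree D n0 dm.
pose T : finType := ('I_m * {ffun 'I_n -> 'I_s.+1})%type.
pose N := #|T|; pose A := {mpoly int[N]}.
(* The generic polynomial of degree at most [s] in each t-variable, with a separate unknown for each
   pair of [i] and a monomial. The equations are the coefficients of [Psi], indexed by the box
   [J]. *)
pose V i : {mpoly A[n]} :=
  \sum_(b : {ffun 'I_n -> 'I_s.+1}) 'X_(enum_rank ((i, b) : T)) *: 'X_[box_mnm b].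
pose Psi : {mpoly A[n]} := mmap (map_mpoly intr) V psi.
pose J : finType := {ffun 'I_n -> 'I_(D + d * s).+1}.
have VP i : box_homog s 1 (V i).
  apply: box_homog_sum => b _ c; rewrite mcoeffZ mcoeffX.
  have [<-|_] := eqVneq; last by rewrite mulr0 dhomog0 eqxx.
  rewrite mulr1 dhomogX /= mdeg1; split=> // _ j; by rewrite mnmE -ltnS.
have PsiP : box_homog (D + d * s) d Psi.
  apply: box_homog_sum => mu mupsi.
  have mud : mdeg mu = d by move/dhomogP: psi_d => /(_ _ mupsi).
  suff c0 : box_homog D 0 (map_mpoly (intr : int -> A) psi@_mu).
    by have := box_homogM c0 (box_homog_mmap1 mu VP); rewrite mud muln1.
  move=> b; rewrite mcoeff_map_mpoly; split.
    by rewrite rpredMz // dhomog1.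
  move=> nz i; have bs : b \in msupp psi@_mu.
    by rewrite mcoeff_msupp; apply: contraNneq nz => ->.
  have le1 : (b i <= mdeg b)%N by rewrite mdegE (bigD1 i) //= leq_addr.
  apply: leq_trans le1 _; apply: leq_trans (ltnW (msize_mdeg_lt bs)) _.
  by rewrite /D (big_rem mu) //= leq_maxl.
exists N, J, (fun b => Psi@_(box_mnm b)); split.
- by move=> b; have [] := PsiP (box_mnm b).
- by rewrite /N card_prod !card_ffun !card_ord.
move=> S y [k yk] Gy.
pose ev : {rmorphism A -> S} := mmap intr y.
exists (fun i => map_mpoly ev (V i)); split.
  have [[i b] kE] : exists t : T, k = enum_rank t.
    by exists (enum_val k); rewrite enum_valK.
  exists i; apply: contraNneq yk => /(congr1 (fun P => P@_(box_mnm b))).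
  rewrite mcoeff0 mcoeff_map_mpoly raddf_sum /= (bigD1 b) //= big1 => [|c cb].
    rewrite addr0 mcoeffZ mcoeffX eqxx mulr1 -kE.
    by rewrite /ev /= mmapX mmap1U => ->.
  by rewrite mcoeffZ mcoeffX (inj_eq (@box_mnm_inj _ _)) (negPf cb) mulr0.
transitivity (map_mpoly ev Psi).
  rewrite mmap_rmorph; congr (mmap _ _ _); apply/funext => f.
  exact: (esym (map_mpoly_intr ev f)).
apply/mpolyP => b; rewrite mcoeff_map_mpoly mcoeff0.
(* A nonzero coefficient of [Psi] lies in the box, hence is one of the equations. *)
have [->|nz] := eqVneq (Psi@_b) 0; first by rewrite raddf0.
by have [c ->] := box_mnmP ((PsiP b).2 nz); apply: Gy.
Qed.

(** * Clearing denominators *)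

Lemma clear_denominators (A : idomainType) (F : fieldType)
    (f : {rmorphism A -> F}) N (p : {mpoly F[N]}) :
    (forall x, exists a b, b != 0 /\ f b * x = f a) ->
  exists c (q : {mpoly A[N]}), c != 0 /\ f c *: p = map_mpoly f q.
Proof.
move=> fP; elim/mpolyind: p => [|x mu p _ _ [c [q [c0 cq]]]].
  by exists 1, 0; rewrite oner_neq0 scaler0 raddf0.
have [a [b [b0 bx]]] := fP x.
exists (b * c), ((a * c) *: 'X_[mu] + b *: q); rewrite mulf_neq0 //; split=> //.
rewrite [RHS]raddfD /= !map_mpolyZ map_mpolyX -cq !rmorphM /= -bx.
by rewrite scalerDr !scalerA mulrAC.
Qed.

Section IntRatfun.
Variable n : nat.
Local Notation tofrac := (@FracField.tofrac {mpoly rat[n]}).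

Definition int_ratfun : {rmorphism {mpoly int[n]} -> ratfun rat n} :=
  tofrac \o map_mpoly (intr : int -> rat).

Lemma int_ratfun_eq0 f : (int_ratfun f == 0) = (f == 0).
Proof.
by rewrite /int_ratfun /= tofrac_eq0 map_mpoly_inj_eq0 //; exact: intr_inj.
Qed.

Lemma ratfun_int_frac (x : ratfun rat n) :
  exists a b, b != 0 /\ int_ratfun b * x = int_ratfun a.
Proof.
have rat_frac (r : rat) : exists a b : int, b != 0 /\ b%:~R * r = a%:~R.
  by exists (numq r), (denq r); rewrite denq_neq0 mulrC numqE.
have := ratfun_repr x; have := denom_ratioP (repr x).
move: (\n_(repr x)) (\d_(repr x)) => u v v0 ->.
have [c [p [c0 cp]]] := clear_denominators u rat_frac.
have [e [q [e0 eq]]] := clear_denominators v rat_frac.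
(* With x = u/v, cu = p and ev = q, both entries acquire the same factor ce. *)
exists (e%:MP * p), (c%:MP * q); rewrite -int_ratfun_eq0.
have v0' : tofrac v != 0 by rewrite tofrac_eq0.
have intC k : int_ratfun k%:MP = tofrac (k%:~R)%:MP.
  by rewrite /int_ratfun /= map_mpolyC.
have -> : int_ratfun (c%:MP * q) = tofrac (c%:~R * e%:~R)%:MP * tofrac v.
  rewrite rmorphM intC /int_ratfun /= -eq -mul_mpolyC -!tofracM.
  by rewrite mulrA mpolyCM.
have -> : int_ratfun (e%:MP * p) = tofrac (c%:~R * e%:~R)%:MP * tofrac u.
  rewrite rmorphM intC /int_ratfun /= -cp -mul_mpolyC -!tofracM.
  by rewrite mulrA mpolyCM [_ * c%:~R%:MP]mulrC.
split; last by rewrite -mulrA; congr (_ * _); rewrite mulrC divfK.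
apply: mulf_neq0 v0'; rewrite tofrac_eq0 mpolyC_eq0.
by apply: mulf_neq0; rewrite intr_eq0.
Qed.

End IntRatfun.

(** * Zeros of integral systems over Z_p for almost all p *)

Lemma dhomog_map_mpoly (A B : nzRingType) (f : {rmorphism A -> B}) n d
    (p : {mpoly A[n]}) : p \is d.-homog -> map_mpoly f p \is d.-homog.
Proof.
move/dhomogP => pd; apply/dhomogP => mu; rewrite mcoeff_msupp mcoeff_map_mpoly.
move=> nz; apply: pd; rewrite mcoeff_msupp; apply: contraNneq nz => ->.
by rewrite raddf0.
Qed.

Lemma dhomog_msize_le (A : nzRingType) n d (p : {mpoly A[n]}) :
  p \is d.-homog -> (msize p <= d.+1)%N.
Proof.
move/dhomogP => pd; rewrite msizeE big_seq.
by apply/bigmax_leqP_seq => mu mup _; rewrite ltnS (pd mu mup).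
Qed.

Lemma dhomog_meval0 (A : comNzRingType) n d (p : {mpoly A[n]}) :
  (0 < d)%N -> p \is d.-homog -> p.@[fun=> 0] = 0.
Proof.
move=> d0 /dhomogP pd; rewrite mevalE big_seq big1 // => mu mup.
have [i mi] : exists i, mu i != 0%N.
  apply/existsP; apply: contraTT d0 => /existsPn mu0.
  rewrite -(pd mu mup) /= mdegE big1 // => i _; apply/eqP.
  by rewrite -[_ == _]negbK.
by rewrite (bigD1 i) //= expr0n (negPf mi) mul0r mulr0.
Qed.

Lemma system_zeros_almost_all_primes (N : nat) (J : finType)
    (G : J -> {mpoly int[N]}) d :
    (0 < d)%N -> (forall j, G j \is d.-homog) -> (d * #|J| < N)%N ->
  exists s : seq nat, forall (p : nat) (pr : prime p), p \notin s ->
    exists y : 'I_N -> padic_int pr,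
      (exists i, y i != 0) /\ forall j, mmap intr y (G j) = 0.
Proof.
move=> d0 Gd dN; apply: contrapT => nex.
pose I := {p : nat | prime p}.
pose solvable (i : I) := exists y : 'I_N -> padic_int (valP i),
  (exists i, y i != 0) /\ forall j, mmap intr y (G j) = 0.
(* The cofinite filter on the bad primes. It is proper because no finite list contains all of them;
   an ultrafilter above it contains the set of bad primes. *)
pose F : set_system I := fun P =>
  exists s : seq nat, forall i, ~ solvable i -> val i \notin s -> P i.
have FF : ProperFilter F.
  apply: Build_ProperFilter_ex.
    move=> P [s sP]; apply: contrapT => nP; apply: nex; exists s => p pr ps.
    apply: contrapT => ns; apply: nP; exists (exist _ p pr); apply: sP => //.
    rewrite /solvable; move: (valP _); rewrite /= => pr'.
    by rewrite (bool_irrelevance pr' pr).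
  split=> [|P Q [s sP] [t tQ]|P Q PQ [s sP]]; first by exists [::].
    exists (s ++ t) => i nsi; rewrite mem_cat negb_or => /andP[si ti].
    by split; [apply: sP | apply: tQ].
  by exists s => i nsi si; apply/PQ/sP.
have [U [UU FU]] := ultraFilterLemma FF.
have U_unsolvable : U (fun i => ~ solvable i) by apply: FU; exists [::].
pose k (i : I) : finFieldType := 'F_(val i).
have zero i : {x : 'I_N -> k i | (exists j, x j != 0) /\
    forall j, mmap intr x (G j) = 0}.
  apply: cid.
  have Gdk j : map_mpoly (intr : int -> k i) (G j) \is d.-homog.
    exact: dhomog_map_mpoly.
  have [x [x0 Gx]] := Chevalley_Warning (fun j => dhomog_msize_le (Gdk j))
    (fun j => dhomog_meval0 d0 (Gdk j)) dN.
  by exists x; split=> // j; rewrite -(Gx j) /meval mmap_map_mpoly.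
pose x i := projT1 (zero i).
(* Only the finitely many prime divisors of m + 1 have to be avoided. *)
have char0 m : U (fun i => m.+1%:R != 0 :> k i).
  apply: FU; exists (primes m.+1) => i _; rewrite mem_primes (valP i) /=.
  by rewrite -(dvdn_pcharf (pchar_Fp (valP i))).
have [y yx yG] := @lift_zeros I U UU (fun i => padic_int (valP i)) k
  (fun i => @padic_residue _ (valP i))
  (fun i => @padic_residue_surj _ (valP i)) (fun i => @padic_hensel _ (valP i))
  char0 N x.
(* The system is finite, so the sets on which the single equations hold can be intersected. *)
have yG0 : U (fun i => forall j, mmap intr (y i) (G j) = 0).
  suff : U (fun i => forall j, j \in enum J -> mmap intr (y i) (G j) = 0).
    by apply: filterS => i yi j; apply: yi; rewrite mem_enum.
  elim: (enum J) => [|j r IHr]; first by apply: filterS filterT.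
  have xj : U (fun i => mmap intr (x i) (G j) = 0).
    by apply: filterS filterT => i _; rewrite /x; case: (zero i) => ? [].
  apply: filterS (filterI (yG _ xj) IHr) => i [yj yr] j'.
  by rewrite inE => /orP[/eqP->|/yr].
have [i [nsi yi]] := filter_ex (filterI U_unsolvable yG0).
apply: nsi; exists (y i); split=> //.
have [j xj] : exists j, x i j != 0 by rewrite /x; case: (zero i) => ? [].
by exists j; apply: contraNneq xj => yj; rewrite -yx yj rmorph0.
Qed.

(** * Transfer to isotropy over Q_p(t_1,...,t_n) *)

(** One integral form [psi], a nonzero multiple of [phi], serves for all p at once; its zeros over
    Z_p[t] embed into Q_p(t). *)
Lemma Qp_isotropic_of_padic_zero d n m (phi : {mpoly (ratfun rat n)[m]}) :
    phi \is d.-homog ->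
  exists2 psi : {mpoly {mpoly int[n]}[m]}, psi \is d.-homog &
    forall (p : nat) (pr : prime p) (w : 'I_m -> {mpoly (padic_int pr)[n]}),
      (exists i, w i != 0) -> mmap (map_mpoly intr) w psi = 0 ->
      isotropic_over (ratfun (Qp pr) n) (ratfun_map (rat_to_Qp pr) n) phi.
Proof.
move=> phi_d; have [c [psi [c0 cpsi]]] := clear_denominators phi (@ratfun_int_frac n).
exists psi.
  apply/dhomogP => mu; rewrite mcoeff_msupp => nz; move/dhomogP: phi_d; apply.
  rewrite mcoeff_msupp; apply: contraNneq nz => phi0.
  rewrite -int_ratfun_eq0 -(mcoeff_map_mpoly (int_ratfun n)) -cpsi mcoeffZ.
  by rewrite phi0 mulr0.
move=> p pr w [i wi] psiw.
pose K := ratfun (Qp pr) n.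
pose io : {rmorphism ratfun rat n -> K} := ratfun_map (rat_to_Qp pr) n.
pose emb : {rmorphism {mpoly (padic_int pr)[n]} -> K} :=
  @FracField.tofrac {mpoly (Qp pr)[n]} \o
    map_mpoly (@FracField.tofrac (padic_int pr)).
exists (fun i => emb (w i)); split.
  exists i; rewrite /emb /= tofrac_eq0 map_mpoly_inj_eq0 //.
  by move=> a b /eqP; rewrite tofrac_eq => /eqP.
(* The maps from Z[t] to Q_p(t) through Z_p[t] and through Q(t) agree. *)
have emb_int f : emb (map_mpoly intr f) = io (int_ratfun n f).
  have -> : io (int_ratfun n f) =
      FracField.tofrac (map_mpoly (rat_to_Qp pr) (map_mpoly intr f)).
    exact: (ratfun_map_poly (rat_to_Qp pr) (map_mpoly intr f)).
  rewrite map_mpoly_intr; apply: (congr1 (@FracField.tofrac {mpoly (Qp pr)[n]})).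
  exact: (map_mpoly_intr (@FracField.tofrac (padic_int pr))).
have := congr1 (fun q => mmap io (fun i => emb (w i)) q) cpsi.
rewrite mmapZ mmap_map_mpoly.
have -> : mmap (io \o int_ratfun n) (fun i => emb (w i)) psi = 0.
  rewrite -(rmorph0 emb) -psiw mmap_rmorph; congr (mmap _ _ _).
  by apply/funext => f; rewrite [RHS]emb_int.
move/eqP; rewrite mulf_eq0 fmorph_eq0 int_ratfun_eq0 (negPf c0) /= => /eqP.
by rewrite /meval mmap_map_mpoly.
Qed.

Local Close Scope ring_scope.

Theorem theorem3 (d n m : nat) (hd : 1 <= d) (hn : 1 <= n)
    (phi : {mpoly (ratfun rat n)[m]})
    (hphi : phi \is d.-homog) (hm : d ^ (n + 2) < m) :
  exists s : seq nat, forall (p : nat) (pr : prime p), p \notin s ->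
    isotropic_over (ratfun (Qp pr) n) (ratfun_map (rat_to_Qp pr) n) phi.
Proof.
have [psi psi_d psiP] := Qp_isotropic_of_padic_zero hphi.
have dm : d ^ n.+1 < m.
  by apply: leq_ltn_trans hm; rewrite addn2 leq_pexp2l.
have [N [J [G [Gd dN GP]]]] := Lang_Nagata_system hn psi_d dm.
have [s sP] := system_zeros_almost_all_primes hd Gd dN.
exists s => p pr ps; have [y [y0 Gy]] := sP p pr ps.
by have [w [w0 psiw]] := GP _ y y0 Gy; apply: psiP psiw.
Qed.
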